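(* There is an absolute constant $C>0$, and for every integer $q\geq 4$ a constant $c_q>0$ depending only on $q$, such that for every positive integer $N$, every $N$-vertex tournament $T$, and every coloring of the edges of $T$ with $q$ colors, $T$ contains a color-avoiding directed path with at least $c_q N^{1-C/\sqrt{\log q}}$ vertices.
   Context: Logarithms are to base $2$. A tournament is an orientation of a complete graph (exactly one directed edge between each pair of distinct vertices). A directed path is a sequence of distinct vertices $v_1,\dots,v_L$ with $v_j\to v_{j+1}$ for all $j<L$; its length is its number of vertices. With colors from $[q]$, a path is color-avoiding if some color of $[q]$ appears on none of its edges. *)

(* Defs.v *)
From mathcomp Require Import all_boot.
From Stdlib Require Export Reals.
Set Implicit Arguments. Unset Strict Implicit. Unset Printing Implicit Defensive.

Definition is_tournament (N : nat) (E : rel 'I_N) : Prop :=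
  (forall x, ~~ E x x) /\ (forall x y, x != y -> E x y = ~~ E y x).

Definition is_dipath (N : nat) (E : rel 'I_N) (p : seq 'I_N) : Prop :=
  match p with
  | [::] => False
  | x :: s => path E x s && uniq p
  end.

(* Edge colouring with colours from [q] = 'I_q: col u v is the colour of the
   edge u -> v (values on non-edges are irrelevant).  A path is colour-avoiding
   if some colour appears on none of its edges. *)
Definition color_avoiding (N q : nat) (col : 'I_N -> 'I_N -> 'I_q)
  (p : seq 'I_N) : Prop :=
  exists k : 'I_q,
    match p with
    | [::] => True
    | x :: s => path (fun a b => col a b != k) x s
    end.

Definition log2 (x : R) : R := (ln x / ln 2)%R.

(* Main.v *)
(* Write G_i for the tournament without the edges of colour i.  A rank r on the
   vertices makes the rank-increasing edges of G_i acyclic; labelling each vertex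
   by the length of the longest increasing path ending there gives a labelling
   f_i with at most M values if every path avoiding i has at most M vertices.
   The conditional entropy of a uniformly random vertex given f_i is then at
   least ln (N / M), so it suffices to choose the ranks such that, averaged over
   the colours, this entropy is at most eps ln N + O_q(1).  The ranks are built
   by induction on a vertex set J, with K = 2^(m^2), Z = 2^m, q >= 2^(6 m^2) and
   eps = 8 / m.
   - If some S in J with |S| >= |J| / Z has an order with few backward edges, cut
     S into K consecutive blocks.  A vertex v whose f_i-quantile in S is far from
     its own block is joined to at least |S| / K vertices of S by edges which are
     backward or of colour i, so this happens for few pairs (v, i); otherwise f_i
     determines the block up to three choices.  Thus about ln K of the entropy is
     gained at a cost of ln Z + O(1).
   - Otherwise every such S contains, for all but few colours i, a path of G_i
     with at least |S| / (2 K^2) vertices, since otherwise a depth-first search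
     order of S would have few backward edges.  Greedily removing such paths
     covers almost all of J by boundedly many paths, and f_i is injective on each
     of them once the rank increases along them. *)
Require Import Defs.
From HB Require Import structures.
From mathcomp Require Import all_boot zify.
From Stdlib Require Import Reals Lra Lia Classical.
Set Implicit Arguments. Unset Strict Implicit. Unset Printing Implicit Defensive.

(** * Real sums and entropy *)

HB.instance Definition _ := Monoid.isComLaw.Build R 0%R Rplus
  (fun x y z => esym (Rplus_assoc x y z)) Rplus_comm Rplus_0_l.
HB.instance Definition _ := Monoid.isMulLaw.Build R 0%R Rmult Rmult_0_l Rmult_0_r.
HB.instance Definition _ := Monoid.isAddLaw.Build R Rmult Rplus
  Rmult_plus_distr_r Rmult_plus_distr_l.

Local Notation "\rsum_ ( i 'in' A ) F" := (\big[Rplus/0%R]_(i in A) F%R)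
  (at level 41, F at level 41, i, A at level 50) : R_scope.
Local Notation "\rsum_ ( i | P ) F" := (\big[Rplus/0%R]_(i | P%B) F%R)
  (at level 41, F at level 41, i at level 50) : R_scope.
Local Notation "\rsum_ i F" := (\big[Rplus/0%R]_i F%R)
  (at level 41, F at level 41, i at level 0, right associativity) : R_scope.

Section RealSums.
Variables (T : finType) (P : pred T).

Lemma rsum_le (F G : T -> R) :
  (forall i, P i -> (F i <= G i)%R) ->
  (\rsum_(i | P i) F i <= \rsum_(i | P i) G i)%R.
Proof.
move=> le_FG; elim/big_rec2: _ => [|i x y Pi le_xy]; first exact: Rle_refl.
exact: Rplus_le_compat (le_FG i Pi) le_xy.
Qed.

Lemma rsum_const (x : R) : (\rsum_(i | P i) x = INR #|P| * x)%R.
Proof.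
rewrite big_const; elim: #|P| => [|n IH]; first by rewrite /= Rmult_0_l.
by rewrite iterS IH S_INR; lra.
Qed.

Lemma rsum_nat (F : T -> nat) :
  (INR (\sum_(i | P i) F i) = \rsum_(i | P i) INR (F i))%R.
Proof. by elim/big_rec2: _ => //= i x y _ <-; rewrite plus_INR. Qed.

Lemma rsum_add (F G : T -> R) :
  (\rsum_(i | P i) (F i + G i) = (\rsum_(i | P i) F i) + \rsum_(i | P i) G i)%R.
Proof. exact: big_split. Qed.

Lemma rsum_mull (a : R) (F : T -> R) :
  (\rsum_(i | P i) (a * F i) = a * \rsum_(i | P i) F i)%R.
Proof. by rewrite big_distrr. Qed.

End RealSums.

Lemma rsum_in_const (T : finType) (A : {set T}) (x : R) :
  (\rsum_(i in A) x = INR #|A| * x)%R.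
Proof. exact: rsum_const. Qed.

Lemma ln_le_sub1 (x : R) : (0 < x -> ln x <= x - 1)%R.
Proof. by move=> x_gt0; have := exp_ineq1_le (ln x); rewrite exp_ln //; lra. Qed.

Lemma ln_le (x y : R) : (0 < x -> x <= y -> ln x <= ln y)%R.
Proof.
move=> x0 [lt_xy|->]; last exact: Rle_refl.
exact/Rlt_le/ln_increasing.
Qed.

Lemma ln_INR_le (m n : nat) : m <= n -> (ln (INR m) <= ln (INR n))%R.
Proof.
case: m => [|m] le_mn; last first.
  by apply: ln_le; [apply: lt_0_INR; lia | apply: le_INR; lia].
(* [ln] takes the default value 0 outside the positive reals, so the case [m = 0] asks for
   [0 <= ln (INR n)]. *)
rewrite /= {1}/ln; case: Rlt_dec => [h|_]; first by have := Rlt_irrefl _ h.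
case: n le_mn => [|n] _.
  by rewrite /= /ln; case: Rlt_dec => [h|_]; [have := Rlt_irrefl _ h | lra].
by rewrite -ln_1; apply: ln_le; [lra | apply: (le_INR 1); lia].
Qed.

Lemma ln_INR_ge0 (n : nat) : (0 <= ln (INR n))%R.
Proof.
have := @ln_INR_le 0 n isT; rewrite /= {1}/ln.
by case: Rlt_dec => [h|_] //; have := Rlt_irrefl _ h.
Qed.

Section Entropy.
Variable V : finType.
Implicit Types (J : {set V}) (f : V -> nat).

Definition fiber J f v : nat := #|[set u in J | f u == f v]|.

(** This is [#|J|] times the conditional entropy, in natural logarithms, of a uniformly random
    vertex of [J] given its label under [f]. *)
Definition ent J f : R := (\rsum_(v in J) ln (INR (fiber J f v)))%R.

Lemma fiber_gt0 J f v : v \in J -> 0 < fiber J f v.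
Proof. by move=> vJ; apply/card_gt0P; exists v; rewrite inE vJ eqxx. Qed.

Lemma fiber_le J f v : fiber J f v <= #|J|.
Proof. by apply: subset_leq_card; apply/subsetP=> u; rewrite inE => /andP[]. Qed.

Lemma ent_le_card J f : (ent J f <= INR #|J| * ln (INR #|J|))%R.
Proof.
rewrite -rsum_in_const; apply: rsum_le => v _.
exact/ln_INR_le/fiber_le.
Qed.

(* Gibbs' inequality: [w x] is a guess for the law of [j] on the fibre of [x]. *)
Lemma ent_split (A : finType) J f (j : V -> A) (w : nat -> A -> R) :
  (forall x a, 0 <= w x a)%R -> (forall x, \rsum_a w x a <= 1)%R ->
  (forall v, v \in J -> 0 < w (f v) (j v))%R ->
  (ent J f <= \rsum_a ent [set v in J | j v == a] f
              + \rsum_(v in J) - ln (w (f v) (j v)))%R.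
Proof.
move=> w_ge0 w_sum w_gt0.
pose Ja a := [set v in J | j v == a].
pose m v := INR (fiber (Ja (j v)) f v).
have -> : (\rsum_a ent (Ja a) f = \rsum_(v in J) ln (m v))%R.
  rewrite [RHS](partition_big j xpredT) //=; apply: eq_bigr => a _.
  rewrite /ent (eq_bigl (fun v => (v \in J) && (j v == a))); last first.
    by move=> v; rewrite inE.
  by apply: eq_bigr => v /andP[_ /eqP ja]; rewrite /m ja.
have m_gt0 v : v \in J -> (0 < m v)%R.
  by move=> vJ; apply: lt_0_INR; apply/ltP/fiber_gt0; rewrite inE vJ eqxx.
(* Applying [ln (t v) <= t v - 1] to every vertex reduces the claim to the sum of [t] over [J] being
   at most [#|J|]. *)
pose t v := (INR (fiber J f v) * (w (f v) (j v) / m v))%R.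
rewrite -rsum_add.
have le1 : (ent J f <= \rsum_(v in J) (ln (m v) + - ln (w (f v) (j v)) + (t v + -1)))%R.
  apply: rsum_le => v vJ.
  have n0 : (0 < INR (fiber J f v))%R by apply: lt_0_INR; apply/ltP/fiber_gt0.
  have m0 := m_gt0 v vJ; have w0 := w_gt0 v vJ.
  have t0 : (0 < t v)%R.
    by apply: Rmult_lt_0_compat => //; apply: Rdiv_lt_0_compat.
  have := ln_le_sub1 t0.
  rewrite {1}/t ln_mult //; last exact: Rdiv_lt_0_compat.
  rewrite /Rdiv ln_mult //; last exact: Rinv_0_lt_compat.
  rewrite ln_Rinv //; move: (t v) (ln _) (ln _) (ln _); intros a b c d h. lra.
apply: (Rle_trans _ _ _ le1); rewrite rsum_add (rsum_add _ t) rsum_in_const.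
suff : (\rsum_(v in J) t v <= INR #|J| * 1)%R by lra.
rewrite -rsum_in_const.
(* The factor [INR (fiber J f v)] becomes a sum over the [u] in the fibre. After exchanging sums,
   for fixed [u] the terms with [j v = a] add up to at most [w (f u) a], and these sum to at most
   1. *)
have -> : (\rsum_(v in J) t v =
    \rsum_(v in J) \rsum_(u | (u \in J) && (f u == f v)) (w (f v) (j v) / m v))%R.
  apply: eq_bigr => v _; rewrite rsum_const /t /fiber; congr (INR _ * _)%R.
  by apply: eq_card => u; rewrite !inE.
rewrite (exchange_big_dep (mem J)) /=; last by move=> v u _ /andP[].
apply: rsum_le => u uJ; apply: Rle_trans (w_sum (f u)).
rewrite (partition_big j xpredT) //=; apply: rsum_le => a _.
pose Q := [pred v | [&& v \in J, (u \in J) && (f u == f v) & j v == a]].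
have -> : (\rsum_(v | (v \in J) && ((u \in J) && (f u == f v)) && (j v == a))
             (w (f v) (j v) / m v) = \rsum_(v | Q v) (w (f u) a / INR #|Q|))%R.
  apply: eq_big => [v|v /andP[/andP[vJ /andP[_ /eqP fuv]] /eqP ja]]; first by rewrite /Q /= -andbA.
  rewrite -fuv ja /m ja; congr (_ / INR _)%R; apply: eq_card => x.
  by rewrite !inE uJ -?fuv [f x == _]eq_sym; case: (x \in J); rewrite //= andbC.
rewrite (rsum_const Q) (_ : #|_| = #|Q|) //; have [->|Q0] := posnP #|Q|; first by rewrite Rmult_0_l.
have : (0 < INR #|Q|)%R by apply: lt_0_INR; apply/ltP.
by move=> ?; right; field; lra.
Qed.

(** A label with [M] values reveals at most [ln M]: [ent_split] is applied to a constant labelling,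
    with [f] itself as the split and the uniform guess [/ INR M]. *)
Lemma ent_ge J f M : (forall v, f v < M) ->
  (INR #|J| * ln (INR #|J|) <= ent J f + INR #|J| * ln (INR M))%R.
Proof.
move=> fM; have [->|/card_gt0P[v0 _]] := posnP #|J|.
  have := @rsum_le V [in J] _ _ (fun v _ => ln_INR_ge0 (fiber J f v)).
  by rewrite rsum_in_const -/(ent J f) /=; lra.
have M0 : 0 < M by apply: leq_ltn_trans (fM v0).
have M0' : (0 < INR M)%R by apply: lt_0_INR; apply/ltP.
pose j v := Ordinal (fM v).
have := @ent_split 'I_M J (fun=> 0) j (fun _ _ => / INR M)%R.
rewrite rsum_in_const.
have -> : ent J (fun=> O) = (INR #|J| * ln (INR #|J|))%R.
  rewrite /ent -rsum_in_const; apply: eq_bigr => v _; congr (ln (INR _)).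
  by apply: eq_card => u; rewrite inE eqxx andbT.
have -> : (\rsum_a ent [set v in J | j v == a] (fun=> O) = ent J f)%R.
  rewrite [RHS](partition_big j xpredT) //=; apply: eq_bigr => a _.
  apply: eq_big => [v|v]; rewrite inE // => /andP[vJ /eqP jv]; congr (ln (INR _)).
  by apply: eq_card => u; rewrite !inE eqxx andbT -jv.
rewrite ln_Rinv // Ropp_involutive; apply=> *.
- exact/Rlt_le/Rinv_0_lt_compat.
- by rewrite rsum_const (_ : #|_| = M) ?card_ord //; right; field; lra.
- exact: Rinv_0_lt_compat.
Qed.

End Entropy.

(** * Backward edges and depth-first search *)

Section BackEdges.
Variable V : finType.
Implicit Types (G : rel V) (s : seq V).

Definition back G s : nat :=
  \sum_(x <- s) \sum_(y <- s) (G y x && (index x s < index y s)).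

(** A backward edge between the two parts would have to run from [s2] to [s1]. *)
Lemma back_cat G s1 s2 : uniq (s1 ++ s2) ->
  {in s2 & s1, forall y x, ~~ G y x} -> back G (s1 ++ s2) = back G s1 + back G s2.
Proof.
rewrite cat_uniq => /and3P[_ /hasPn disj _] noG.
have ix1 x : x \in s1 -> index x (s1 ++ s2) = index x s1 by move=> xs; rewrite index_cat xs.
have ix2 x : x \in s2 -> index x (s1 ++ s2) = size s1 + index x s2.
  by move=> xs; rewrite index_cat (negbTE (disj x xs)).
rewrite /back big_cat /=; congr (_ + _); apply: eq_big_seq => x xs; rewrite big_cat /=.
  rewrite [X in _ + X]big1_seq ?addn0 => [|y /andP[_ ys]]; last first.
      by rewrite (negbTE (noG y x ys xs)).
  by apply: eq_big_seq => y ys; rewrite !ix1.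
rewrite big1_seq ?add0n => [|y /andP[_ ys]].
  by apply: eq_big_seq => y ys; rewrite !ix2 // ltn_add2l.
rewrite ix2 // ix1 // ltnNge (leq_trans _ (leq_addr _ _)) ?andbF //.
by rewrite ltnW // index_mem.
Qed.

Lemma back_cons G x s : x \notin s -> back G (x :: s) <= size s + back G s.
Proof.
move=> xs; rewrite /back big_cons; apply: leq_add.
  rewrite big_cons /= eqxx andbF add0n -sum1_size leq_sum // => y _.
  exact: leq_b1.
rewrite !big_seq leq_sum // => z zs; rewrite big_cons /=.
have xz : x != z by apply: contraNneq xs => ->.
rewrite (negbTE xz) eqxx ltn0 andbF add0n !big_seq leq_sum // => y ys.
have xy : x != y by apply: contraNneq xs => ->.
by rewrite (negbTE xy) ltnS.
Qed.

(* Depth-first search from [x], with later-visited subtrees put first: the only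
   backward edges lead from a vertex to an ancestor, and a branch is a path. *)
Lemma dfs_branch G (U : {set V}) x t : x \notin U ->
  (forall p, uniq p -> {subset p <= U} -> path G x p -> size p <= t) ->
  exists s, [/\ uniq s, {subset s <= U},
    forall y z, y \in x :: s -> z \in U -> z \notin s -> ~~ G y z
    & back G s <= t * size s].
Proof.
elim: {U}_.+1 {-2}U (ltnSn #|U|) x t => // n IH U leUn x t xU short.
have [/existsP[w /andP[wU Gxw]]|/existsPn none] := boolP [exists w, (w \in U) && G x w]; last first.
  exists [::]; split=> // [y z|]; last by rewrite /back big_nil.
  rewrite inE => /eqP-> zU _; apply: contraNN (none z) => ->.
  by rewrite zU.
(* The subtree below [w] is searched first; a path leaving [w] extends backward to [x], so the
   length bound drops to [t.-1]. *)
have ltU : #|U :\ w| < n by move: leUn; rewrite (cardsD1 w U) wU; lia.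
have [||s' [us' s'U out' bk']] := IH _ ltU w t.-1.
- by rewrite !inE eqxx.
- move=> p up pU Gp; have := short (w :: p).
  rewrite /= Gxw up Gp andbT; case: t {short IH} => [|t] /=.
    move=> h; suff: size p < 0 by []; apply: h => //.
      by apply/negP=> /pU; rewrite !inE eqxx.
    by move=> y; rewrite inE => /predU1P[->|/pU]; rewrite // !inE => /andP[].
  apply=> //; first by apply/negP=> /pU; rewrite !inE eqxx.
  by move=> y; rewrite inE => /predU1P[->|/pU]; rewrite // !inE => /andP[].
(* The search resumes from [x] among the vertices not reached through [w]. *)
pose U2 := [set z in U :\ w | z \notin s'].
have U2U : {subset U2 <= U} by move=> y; rewrite !inE => /andP[/andP[]].
have [|||s2 [us2 s2U out2 bk2]] := IH U2 _ x t.
- apply: leq_ltn_trans ltU; apply: subset_leq_card; apply/subsetP=> y.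
  by rewrite inE => /andP[].
- by apply: contraNN xU => /U2U.
- by move=> p up pU Gp; apply: short => // y /pU /U2U.
have ws' : w \notin s' by apply/negP=> /s'U; rewrite !inE eqxx.
have us : uniq (s2 ++ w :: s').
  rewrite cat_uniq us2 cons_uniq ws' us' !andbT; apply/hasPn=> y ys'.
  apply/negP => /s2U; rewrite !inE; move: ys'; rewrite inE => /orP[->|->] //.
  by rewrite andbF.
exists (s2 ++ w :: s'); split=> //.
- move=> y; rewrite mem_cat inE => /or3P[/s2U/U2U|/eqP->|/s'U] //.
  by rewrite inE => /andP[].
- move=> y z ys zU; rewrite mem_cat inE !negb_or => /and3P[zs2 zw zs'].
  have zU1 : z \in U :\ w by rewrite !inE zw.
  have zU2 : z \in U2 by rewrite inE zU1.
  move: ys; rewrite -cat_cons mem_cat => /orP[ys|ys]; first exact: out2.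
  exact: out'.
- rewrite back_cat // => [|y z ys /s2U]; last first.
    by rewrite inE => /andP[zU1 zs']; apply: out'.
  rewrite size_cat mulnDr leq_add // (leq_trans (back_cons _ ws')) //=.
  (* The at most [size s'] backward edges into [w] and the at most [t.-1 * size s'] inside its
     subtree fit into [t * (size s').+1] once [t] is positive. *)
  have t0 : 0 < t.
    apply: (short [:: w]) => //=; last by rewrite Gxw.
    by move=> y; rewrite inE => /eqP->.
  move: bk'; case: t t0 {short out2 bk2} => // t _ /= bk'.
  by rewrite mulSn mulnS; lia.
Qed.

(** The search restarts until [S] is exhausted, each new tree going in front of the earlier ones. No
    edge leads from a finished tree to a vertex still unvisited, so all backward edges stay inside
    trees. *)
Lemma dfs_order G (S : {set V}) t :
  (forall x p, uniq (x :: p) -> {subset x :: p <= S} -> path G x p -> size p < t) ->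
  exists s, [/\ uniq s, s =i S & back G s <= t * #|S|].
Proof.
elim: {S}_.+1 {-2}S (ltnSn #|S|) => // n IH S leSn short.
have [->|[x xS]] := set_0Vmem S.
  by exists [::]; split=> // [y|]; rewrite ?inE // /back big_nil.
have t0 : 0 < t.
  by apply: (short x [::]) => // y; rewrite inE => /eqP->.
have [||s1 [us1 s1S out bk1]] := @dfs_branch G (S :\ x) x t.-1.
- by rewrite !inE eqxx.
- move=> p up pS Gp; rewrite -ltnS prednK ?t0 //.
  apply: (short x) => //=.
    by rewrite up andbT; apply/negP=> /pS; rewrite !inE eqxx.
  by move=> y; rewrite inE => /predU1P[->|/pS]; rewrite // !inE => /andP[].
have xs1 : x \notin s1 by apply/negP=> /s1S; rewrite !inE eqxx.
pose S2 := [set z in S :\ x | z \notin s1].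
have S2S : {subset S2 <= S} by move=> y; rewrite !inE => /andP[/andP[]].
have [||s2 [us2 s2S bk2]] := IH S2.
- move: leSn; rewrite (cardsD1 x S) xS /= ltnS; apply: leq_trans.
  by rewrite add1n ltnS; apply: subset_leq_card; apply/subsetP=> y; rewrite inE => /andP[].
- by move=> y p up pS; apply: short => // z /pS /S2S.
have us : uniq (s2 ++ x :: s1).
  rewrite cat_uniq us2 cons_uniq xs1 us1 !andbT; apply/hasPn=> y ys.
  apply/negP; rewrite s2S !inE; move: ys; rewrite inE => /orP[->|->] //.
  by rewrite andbF.
have eS : s2 ++ x :: s1 =i S.
  move=> y; rewrite mem_cat inE s2S !inE.
  have [->|yx] := eqVneq y x; first by rewrite xS orbT.
  have [/s1S|] := boolP (y \in s1); first by rewrite !inE yx /= => ->; rewrite !orbT.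
  by move=> _; case: (y \in S).
exists (s2 ++ x :: s1); split=> //.
have -> : #|S| = size s2 + (size s1).+1.
  by rewrite -(eq_card eS) (card_uniqP us) size_cat.
rewrite back_cat // => [|y z ys]; last first.
  by rewrite s2S inE => /andP[zU1 zs1]; apply: out.
rewrite mulnDr leq_add //.
  by have <- : #|S2| = size s2 by rewrite -(eq_card s2S) (card_uniqP us2).
apply: leq_trans (back_cons _ xs1) _.
by move: bk1; case: t t0 {IH short bk2} => // t _ /=; rewrite mulSn mulnS; lia.
Qed.

End BackEdges.

(** * Sets far from transitive *)

Section Tournament.
Variables (V I : finType) (E : rel V) (col : V -> V -> I).
Implicit Types (J S U : {set V}) (i : I) (f r : V -> nat).

Definition avoid i : rel V := fun x y => E x y && (col x y != i).

(** The entropy bounds are proved for every such labelling, not just for the longest-path one, so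
    that they can be reused on pieces of a set whose ranks are merged. *)
Definition compatible i J r f : Prop :=
  forall u v, u \in J -> v \in J -> avoid i u v -> r u < r v -> f u < f v.

Definition col_edges i S : nat :=
  \sum_(x in S) \sum_(y in S) (E y x && (col y x == i)).

Lemma back_avoid i S s : uniq s -> s =i S -> back E s <= back (avoid i) s + col_edges i S.
Proof.
move=> us sS; rewrite /back /col_edges.
rewrite -[X in _ + X](eq_bigl _ _ sS) -(big_uniq _ us) /= -big_split /= leq_sum // => x _.
rewrite -(eq_bigl _ _ sS) -(big_uniq _ us) /= -big_split /= leq_sum // => y _.
by rewrite /avoid; case: (E y x); case: (_ < _); case: (_ == i).
Qed.

(** Were all paths short, a depth-first order would have at most [#|S| * #|S| / (2 * (K * K))]
    backward edges avoiding [i], and fewer than that many edges have colour [i]. Together this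
    contradicts being far from transitive. *)
Lemma far_long_path K i S : 0 < K ->
  (forall s, uniq s -> s =i S -> #|S| * #|S| < K * K * back E s) ->
  2 * (K * K) * col_edges i S < #|S| * #|S| ->
  exists x p, [/\ uniq (x :: p), {subset x :: p <= S}, path (avoid i) x p
    & #|S| <= 2 * (K * K) * size (x :: p)].
Proof.
move=> K0 far sparse; apply: NNPP => nopath.
pose t := #|S| %/ (2 * (K * K)).
have [|s [us sS bk]] := @dfs_order V (avoid i) S t.
  move=> x p up pS Gp; rewrite /t leq_divRL; last by rewrite !muln_gt0 K0.
  rewrite mulnC; apply: ltnW; rewrite ltnNge; apply/negP => h; apply: nopath.
  by exists x, p.
have := far s us sS; have := back_avoid i us sS.
have : t * (2 * (K * K)) <= #|S| by apply: leq_trunc_div.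
move: bk sparse; nia.
Qed.

(** Paths are removed greedily while more than [#|J| / Z] vertices remain. Here [k] numbers the path
    through a vertex, with 0 for the leftover. Each path has more than [#|J| / (T * Z)] vertices,
    which bounds their number. *)
Lemma extract_paths i (T Z : nat) J U :
  (forall S, S \subset J -> #|J| <= Z * #|S| ->
    exists x p, [/\ uniq (x :: p), {subset x :: p <= S}, path (avoid i) x p
      & #|S| <= T * size (x :: p)]) ->
  U \subset J ->
  exists (r k : V -> nat) t,
    [/\ forall v, v \in U -> k v <= t, t * #|J| <= T * Z * #|U|,
        Z * #|[set v in U | k v == 0]| <= #|J|
      & forall f, compatible i U r f ->
        forall u v, u \in U -> v \in U -> k u = k v -> 0 < k u -> f u = f v -> u = v].
Proof.
move=> paths; elim: {U}_.+1 {-2}U (ltnSn #|U|) => // n IH U leUn UJ.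
have [small|big] := leqP (Z * #|U|) #|J|.
  exists (fun=> 0), (fun=> 0), 0; split=> //.
  apply: leq_trans small; rewrite leq_mul2l subset_leq_card ?orbT //.
  by apply/subsetP=> v; rewrite inE => /andP[].
have [x [p [up pU Gp lenp]]] := paths U UJ (ltnW big).
move Es : (x :: p) => s in up pU lenp.
pose U' := [set v in U | v \notin s].
have U'U : U' \subset U by apply/subsetP=> v; rewrite inE => /andP[].
have cU : #|U| = #|U'| + size s.
  rewrite -(card_uniqP up) addnC -[LHS](cardsID [set v in s]); congr (_ + _).
    by apply: eq_card => v; rewrite !inE; apply/andb_idl => /pU.
  by apply: eq_card => v; rewrite !inE andbC.
have [||r [k [t [kt tJ k0 inj]]]] := IH U'.
- by move: leUn; rewrite cU -Es /=; lia.
- exact: subset_trans U'U UJ.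
(* The new path gets the largest number and ranks increasing along it; shifting the other ranks by
   [size s] keeps their order. *)
exists (fun v => if v \in s then index v s else r v + size s),
       (fun v => if v \in s then t.+1 else k v), t.+1; split.
- move=> v vU; case: ifP => // vs; apply/leqW/kt.
  by rewrite inE vU vs.
- have : Z * #|U| <= Z * (T * size s) by rewrite leq_mul2l lenp orbT.
  by rewrite cU; nia.
- apply: leq_trans k0; rewrite leq_mul2l subset_leq_card ?orbT //.
  by apply/subsetP=> v; rewrite !inE; case: (v \in s) => /andP[-> //].
move=> f fU u v uU vU.
have fpath : path (fun a b => f a < f b) x p.
  have us : uniq (x :: p) by rewrite Es.
  apply/(pathP x) => j jp; apply: fU.
  - by apply: pU; rewrite -Es mem_nth //= ltnW.
  - by apply: pU; rewrite -Es inE mem_nth ?orbT.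
  - exact: (pathP x Gp).
  - have j1 : nth x (x :: p) j \in s by rewrite -Es mem_nth //= ltnW.
    have j2 : nth x (x :: p) j.+1 \in s by rewrite -Es mem_nth.
    rewrite j1 -[nth x p j]/(nth x (x :: p) j.+1) j2 -Es !index_uniq //=.
    exact: ltnW.
have fs a b : a \in s -> b \in s -> index a s < index b s -> f a < f b.
  have := @sorted_ltn_index V (fun a b => f a < f b) _ s; rewrite -Es; apply=> //.
  by move=> b' a' c'; apply: ltn_trans.
case: ifP => us; case: ifP => vs.
- move=> _ _ fuv; case: (ltngtP (index u s) (index v s)) => [h|h|h].
  + by have := fs u v us vs h; rewrite fuv ltnn.
  + by have := fs v u vs us h; rewrite fuv ltnn.
  + by rewrite -(nth_index x us) h nth_index.
- move=> kk; have : k v <= t by apply: kt; rewrite inE vU vs.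
  by rewrite -kk ltnn.
- move=> kk; have : k u <= t by apply: kt; rewrite inE uU us.
  by rewrite kk ltnn.
apply: inj; rewrite ?inE ?uU ?vU ?us ?vs //.
move=> a b; rewrite !inE => /andP[aU /negbTE as'] /andP[bU /negbTE bs] Gab rab.
by apply: fU; rewrite // as' bs ltn_add2r.
Qed.

(** The leftover is at most a [1 / Z] fraction of [J] and gets the trivial bound; every other vertex
    is determined by its label and its path number, and guessing that number costs the last term. *)
Lemma ent_paths i (T Z : nat) J : 0 < T -> 0 < Z ->
  (forall S, S \subset J -> #|J| <= Z * #|S| ->
    exists x p, [/\ uniq (x :: p), {subset x :: p <= S}, path (avoid i) x p
      & #|S| <= T * size (x :: p)]) ->
  exists r, forall f, compatible i J r f ->
    (ent J f <= INR #|J| * (ln (INR #|J|) / INR Z + ln (INR (2 * (T * Z)))))%R.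
Proof.
move=> T0 Z0 /extract_paths/(_ (subxx J))[r [k [t [kt tJ k0 inj]]]].
exists r => f fJ; pose N := T * Z.
have [J0|J0] := posnP #|J|.
  by apply: Rle_trans (ent_le_card J f) _; rewrite J0 !Rmult_0_l; right.
have tN : t <= N by move: tJ; rewrite leq_pmul2r.
have N0 : 0 < N by rewrite muln_gt0 T0.
have N1 : (1 <= INR N)%R by apply: (le_INR 1); lia.
pose j v : 'I_N.+1 := inord (k v).
have jE v : v \in J -> j v = k v :> nat.
  by move=> vJ; rewrite inordK // ltnS; apply: leq_trans (kt v vJ) tN.
(* The guess ignores the label: half of the mass on the leftover, the rest uniform over the [N]
   possible path numbers. *)
pose w (x : nat) (a : 'I_N.+1) := (if a == ord0 then / 2 else / (2 * INR N))%R.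
have w0 x a : (0 < w x a)%R.
  by rewrite /w; case: ifP => _; apply: Rinv_0_lt_compat; lra.
have lnw x a : (- ln (w x a) <= ln (INR (2 * N)))%R.
  rewrite mult_INR /=; rewrite /w; case: ifP => _; rewrite ln_Rinv; try lra.
    by rewrite Ropp_involutive; apply: ln_le; lra.
  by right; rewrite Ropp_involutive; congr ln; lra.
have := @ent_split V 'I_N.+1 J f j w (fun x a => Rlt_le _ _ (w0 x a)) _ (fun v _ => w0 _ _).
move=> /(_ _)/Rle_trans; apply.
  move=> x; rewrite big_ord_recl /w eqxx /=.
  rewrite (eq_bigr (fun=> / (2 * INR N))%R) // rsum_const (_ : #|_| = N) ?card_ord //.
  by right; field; lra.
rewrite Rmult_plus_distr_l; apply: Rplus_le_compat; last first.
  by rewrite -rsum_in_const; apply: rsum_le => v _; apply: lnw.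
rewrite big_ord_recl [X in (_ + X)%R]big1 => [|a _].
  rewrite Rplus_0_r; apply: Rle_trans (ent_le_card _ _) _.
  set J' := [set v in J | _].
  have J'J : #|J'| <= #|J|.
    by apply: subset_leq_card; apply/subsetP=> v; rewrite inE => /andP[].
  have cJ' : Z * #|J'| <= #|J|.
    apply: leq_trans k0; rewrite leq_mul2l subset_leq_card ?orbT //.
    apply/subsetP=> v; rewrite !inE => /andP[vJ /eqP jv].
    by rewrite vJ -(jE v vJ) jv.
  have Z0' : (0 < INR Z)%R by apply: lt_0_INR; apply/ltP.
  have : (INR Z * INR #|J'| <= INR #|J|)%R by rewrite -mult_INR; apply: le_INR; apply/leP.
  have := ln_INR_le J'J; have := ln_INR_ge0 #|J|; have := pos_INR #|J'| => h1 h2 h3 h4.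
  apply: (Rle_trans _ (INR #|J'| * ln (INR #|J|))); first exact: Rmult_le_compat_l.
  apply: (Rmult_le_reg_l (INR Z)) => //.
  have -> : (INR Z * (INR #|J| * (ln (INR #|J|) / INR Z)) = INR #|J| * ln (INR #|J|))%R.
    by field; lra.
  by rewrite -Rmult_assoc; apply: Rmult_le_compat_r.
(* On a single path [f] is injective, so all fibres are singletons. *)
rewrite /ent big1 // => v; rewrite inE => /andP[vJ /eqP jv].
rewrite (_ : fiber _ f v = 1) ?ln_1 //.
rewrite /fiber -[RHS](cards1 v); apply: eq_card => u; rewrite !inE.
apply/andP/eqP => [[/andP[uJ /eqP ju] /eqP fuv]|->]; last by rewrite vJ jv !eqxx.
by apply: (inj f fJ) => //; rewrite -(jE u uJ) -?(jE v vJ) ju ?jv.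
Qed.

End Tournament.

(** * Counting lemmas *)

Lemma leq_sum_subset (T : finType) (A B : {set T}) (F : T -> nat) :
  A \subset B -> \sum_(x in A) F x <= \sum_(x in B) F x.
Proof. by move=> AB; rewrite [leqRHS](big_setID A) /= (setIidPr AB) leq_addr. Qed.

Lemma sum_card_preim (T A : finType) (B : {set T}) (j : T -> A) :
  \sum_a #|[set v in B | j v == a]| = #|B|.
Proof.
rewrite -sum1_card (partition_big j xpredT) //=; apply: eq_bigr => a _.
by rewrite -sum1_card; apply: eq_bigl => v; rewrite inE.
Qed.

Lemma card_index_lt (T : finType) (s : seq T) n : uniq s ->
  #|[set w in s | index w s < n]| = minn n (size s).
Proof.
move=> us; rewrite -size_take_min -(card_uniqP (take_uniq n us)).
apply: eq_card => w; rewrite inE; have [ws|ws] := boolP (w \in s).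
  by rewrite in_take.
by apply/esym/negbTE; apply: contraNN ws => /mem_take.
Qed.

(** * Far sets: entropy summed over the colours *)

Section LeafStep.
Variables (V I : finType) (E : rel V) (col : V -> V -> I).
Implicit Types (J S U : {set V}) (i : I).

Lemma col_edges_subset i S J : S \subset J -> col_edges E col i S <= col_edges E col i J.
Proof.
move=> SJ; apply: leq_trans (leq_sum_subset _ SJ); apply: leq_sum => x _.
exact: leq_sum_subset.
Qed.

Lemma sum_col_edges J : \sum_i col_edges E col i J <= #|J| * #|J|.
Proof.
rewrite /col_edges exchange_big /= -sum_nat_const leq_sum // => x _.
rewrite exchange_big /= -sum1_card leq_sum // => y _.
rewrite (bigD1 (col y x)) //= big1 ?addn0 ?leq_b1 // => i.
by rewrite eq_sym => /negbTE->; rewrite andbF.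
Qed.

(** A dense colour has at least [#|J| * #|J| / (2 * (K * K) * (Z * Z))] edges inside [J], so at most
    [2 * (K * K) * (Z * Z)] colours are dense; they get the trivial bound. For the others
    [far_long_path] feeds [ent_paths] with [T = 2 * (K * K)]. *)
Lemma far_step K Z J : 0 < K -> 0 < Z ->
  (forall s, uniq s -> {subset s <= J} -> #|J| <= Z * size s ->
    size s * size s < K * K * back E s) ->
  exists r : I -> V -> nat, forall f : I -> V -> nat,
    (forall i, compatible E col i J (r i) (f i)) ->
    (\rsum_i ent J (f i) <= INR #|J| *
       (ln (INR #|J|) * (INR #|I| / INR Z + INR (2 * (K * K) * (Z * Z)))
        + INR #|I| * ln (INR (2 * (2 * (K * K) * Z)))))%R.
Proof.
move=> K0 Z0 far.
pose dense i := [exists S : {set V}, [&& S \subset J, #|J| <= Z * #|S|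
  & #|S| * #|S| <= 2 * (K * K) * col_edges E col i S]].
set X := ln (INR #|J|); set Y := ln (INR (2 * (2 * (K * K) * Z))).
have X0 : (0 <= X)%R := ln_INR_ge0 _.
have Y0 : (0 <= Y)%R := ln_INR_ge0 _.
have J0 := pos_INR #|J|.
have Zr : (0 < INR Z)%R by apply: lt_0_INR; apply/ltP.
have XZ : (0 <= X / INR Z)%R by apply: Rmult_le_pos => //; apply/Rlt_le/Rinv_0_lt_compat.
have pick i : exists r, forall f, compatible E col i J r f ->
    (ent J f <= INR #|J| * (X / INR Z + Y) + INR (dense i) * (INR #|J| * X))%R.
  have [di|ndi] := boolP (dense i).
    exists (fun=> O) => f _; have := ent_le_card J f; rewrite -/X /=.
    by have := Rmult_le_pos _ _ J0 (Rplus_le_le_0_compat _ _ XZ Y0); lra.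
  have [|S SJ cS|r rP] := @ent_paths _ _ E col i (2 * (K * K)) Z J _ Z0.
  - by rewrite !muln_gt0 K0.
  - apply: far_long_path => // [s us sS|].
      rewrite -(eq_card sS) (card_uniqP us); apply: far => //.
        by move=> v; rewrite sS; apply: (subsetP SJ).
      by rewrite -(card_uniqP us) (eq_card sS).
    by rewrite ltnNge; apply: contraNN ndi => h; apply/existsP; exists S; rewrite SJ cS.
  by exists r => f /rP; rewrite -/X -/Y /=; lra.
have [r rP] := fin_all_exists pick.
exists r => f fP; apply: Rle_trans (rsum_le (fun i _ => rP i (f i) (fP i))) _.
rewrite rsum_add rsum_const.
have -> : (\rsum_i (INR (dense i) * (INR #|J| * X)) =
    INR (\sum_i dense i) * (INR #|J| * X))%R by rewrite rsum_nat big_distrl.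
suff D : (INR (\sum_i dense i) * (INR #|J| * X)
          <= INR (2 * (K * K) * (Z * Z)) * (INR #|J| * X))%R.
  rewrite (_ : #|_| = #|I|) //; apply: Rle_trans (Rplus_le_compat_l _ _ _ D) _.
  by right; field; lra.
have [->|Jpos] := posnP #|J|; first by rewrite /= !Rmult_0_l !Rmult_0_r; lra.
apply: Rmult_le_compat_r; first exact: Rmult_le_pos.
apply/le_INR/leP; rewrite -(leq_pmul2r (_ : 0 < #|J| * #|J|)) ?muln_gt0 ?Jpos //.
apply: (@leq_trans (2 * (K * K) * (Z * Z) * \sum_i col_edges E col i J)); last first.
  by rewrite leq_mul2l sum_col_edges orbT.
rewrite big_distrl big_distrr /= leq_sum // => i _.
have [/existsP[S /and3P[SJ cS dS]]|_] := boolP (dense i); last by rewrite mul0n.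
have := col_edges_subset i SJ; rewrite mul1n.
have : #|J| * #|J| <= (Z * #|S|) * (Z * #|S|) by apply: leq_mul.
move: dS; move: (col_edges _ _ _ S) (col_edges _ _ _ J) => eS eJ dS JS eSJ.
apply: leq_trans JS _; apply: (@leq_trans (Z * Z * (#|S| * #|S|))); first by nia.
apply: (@leq_trans (Z * Z * (2 * (K * K) * eS))); first by rewrite leq_mul2l dS orbT.
rewrite (_ : Z * Z * _ = 2 * (K * K) * (Z * Z) * eS); last by lia.
by rewrite leq_mul2l eSJ orbT.
Qed.

End LeafStep.

(** * Entropy cost of cutting an order into blocks *)

Section Blocks.
Variables (V : finType) (s : seq V) (K b : nat).
Hypothesis idxK : forall v, v \in s -> index v s %/ b < K.

(** The extra value [K] collects the vertices outside [s]. *)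
Definition block v : 'I_K.+1 := if v \in s then inord (index v s %/ b) else ord_max.

Lemma blockE v : v \in s -> block v = index v s %/ b :> nat.
Proof. by move=> vs; rewrite /block vs inordK // ltnS ltnW // idxK. Qed.

Lemma block_out v : v \notin s -> block v = K :> nat.
Proof. by rewrite /block => /negbTE->. Qed.

Definition close (x y : nat) : bool := (x <= y.+1) && (y <= x.+1).

Lemma sum_close g : \sum_(a < K) close a g <= 3.
Proof.
have one x : \sum_(a < K) (a == x :> nat) <= 1.
  have [xK|Kx] := ltnP x K.
    rewrite (bigD1 (Ordinal xK)) //= eqxx big1 // => a; rewrite -val_eqE /= => /negbTE->.
    by [].
  by rewrite big1 // => a _; rewrite ltn_eqF // (leq_trans (ltn_ord a)).
apply: leq_trans (leq_add (leq_add (one g.-1) (one g)) (one g.+1)).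
rewrite -!big_split /= leq_sum // => a _; rewrite /close.
lia.
Qed.

(** The label predicts the block [g (f v)]. A vertex of [s] pays [ln Z] for lying in [s] and [ln 4]
    if the prediction is off by at most one, with a further [ln K] otherwise; the vertices outside
    [s] pay at most [size s] together. *)
Lemma ent_blocks Z (J : {set V}) (f : V -> nat) (g : nat -> nat) :
  uniq s -> {subset s <= J} -> 0 < size s -> #|J| <= Z * size s -> 0 < K ->
  (ent J f <= \rsum_a ent [set v in J | block v == a] f
     + (INR (size s) * (ln (INR Z) + ln 4 + 1)
        + ln (INR K) * INR #|[set v in s | ~~ close (index v s %/ b) (g (f v))]|))%R.
Proof.
move=> us sJ s0 JZ K0; set bad := #|[set v in s | ~~ _]|.
have sJc : size s <= #|J|.
  by rewrite -(card_uniqP us); apply: subset_leq_card; apply/subsetP.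
have sr : (0 < INR (size s))%R by apply: lt_0_INR; apply/ltP.
have sJr : (INR (size s) <= INR #|J|)%R by apply/le_INR/leP.
have Jr : (0 < INR #|J|)%R by lra.
have Kr : (1 <= INR K)%R by apply: (le_INR 1); apply/leP.
have Z0 : 0 < Z by case: Z JZ => //; rewrite mul0n leqNgt (leq_trans s0).
have Zr : (0 < INR Z)%R by apply: lt_0_INR; apply/ltP.
have JZr : (INR #|J| <= INR Z * INR (size s))%R by rewrite -mult_INR; apply/le_INR/leP.
pose p := (INR (size s) / INR #|J|)%R.
have p0 : (0 < p)%R by apply: Rdiv_lt_0_compat.
have p1 : (p <= 1)%R.
  by apply: (Rmult_le_reg_r (INR #|J|)) => //; rewrite /p; field_simplify; lra.
have lnp : (- ln p <= ln (INR Z))%R.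
  rewrite -ln_Rinv //; apply: ln_le; first exact: Rinv_0_lt_compat.
  apply: (Rmult_le_reg_r (INR (size s))) => //.
  by rewrite /p (_ : (_ * _ = INR #|J|)%R) //; field; lra.
(* Mass [1 - p] goes outside [s]. Of the mass [p], each of the at most three close blocks gets a
   quarter, and the last quarter is uniform over all [K] blocks. *)
pose w x (a : 'I_K.+1) : R :=
  (if a == K :> nat then 1 - p else p * (INR (close a (g x)) / 4 + / (4 * INR K)))%R.
have K4 : (0 < / (4 * INR K))%R by apply: Rinv_0_lt_compat; lra.
have := @ent_split V 'I_K.+1 J f block w _ _ _.
have w_in x (a : 'I_K.+1) : a != K :> nat ->
    w x a = (p * (INR (close a (g x)) / 4 + / (4 * INR K)))%R.
  by move=> /negbTE aK; rewrite /w aK.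
have win_gt0 x (a : 'I_K.+1) : (0 < p * (INR (close a (g x)) / 4 + / (4 * INR K)))%R.
  by apply: Rmult_lt_0_compat => //; have := pos_INR (close a (g x)); lra.
have aK v : v \in s -> (block v != K :> nat).
  by move=> vs; rewrite blockE // ltn_eqF // idxK.
have Jcard : INR #|J| = (INR (size s) + INR #|[set v in J | v \notin s]|)%R.
  rewrite -plus_INR -(card_uniqP us) -(cardsID [set v in s] J); congr (INR (_ + _)).
    by apply: eq_card => v; rewrite !inE; apply/andb_idl => /sJ.
  by apply: eq_card => v; rewrite !inE andbC.
have out v : v \in J -> v \notin s -> (0 < 1 - p)%R.
  move=> vJ vs.
  have : (0 < INR #|[set v in J | v \notin s]|)%R.
    by apply: lt_0_INR; apply/ltP/card_gt0P; exists v; rewrite inE vJ.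
  move=> h; have -> : (1 - p = INR #|[set v in J | v \notin s]| / INR #|J|)%R.
    by rewrite /p Jcard; field; lra.
  exact: Rdiv_lt_0_compat.
move=> /(_ _ _ _)/Rle_trans; apply.
- move=> x a; rewrite /w; case: ifP => _; first lra.
  exact/Rlt_le/win_gt0.
- move=> x; rewrite big_ord_recr /= {2}/w eqxx.
  rewrite (eq_bigr (fun a : 'I_K =>
     (p * (INR (close a (g x)) / 4 + / (4 * INR K)))%R)); last first.
    by move=> a _; rewrite w_in //= ltn_eqF.
  rewrite rsum_mull rsum_add rsum_const (_ : #|_| = K) ?card_ord //.
  rewrite (eq_bigr (fun a : 'I_K => (/ 4 * INR (close a (g x)))%R)); last first.
    by move=> a _; lra.
  rewrite rsum_mull -rsum_nat.
  have : (INR (\sum_(a < K) close a (g x)) <= 3)%R.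
    by have := le_INR _ _ (elimT leP (sum_close (g x))); rewrite /=; lra.
  set t := INR _ => t3.
  have -> : (INR K * / (4 * INR K) = / 4)%R by field; lra.
  have : (p * (/ 4 * t + / 4) <= p * 1)%R by apply: Rmult_le_compat_l; lra.
  by lra.
- move=> v vJ; have [vs|vs] := boolP (v \in s); first by rewrite w_in ?aK.
  by rewrite /w block_out // eqxx; apply: out vJ vs.
apply: Rplus_le_compat_l.
rewrite (bigID (fun v => v \in s)) /=.
have in_s : (\rsum_(v | (v \in J) && (v \in s)) - ln (w (f v) (block v))
    <= INR (size s) * (ln (INR Z) + ln 4)
       + ln (INR K) * INR bad)%R.
  rewrite (eq_bigl (fun v => v \in [set v in s])); last first.
    by move=> v; rewrite inE; apply/andb_idl => /sJ.
  have -> : size s = #|[set v in s]| by rewrite cardsE; apply/esym/card_uniqP.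
  have -> : INR bad =
      (\rsum_(v in [set v in s]) INR (~~ close (index v s %/ b) (g (f v))))%R.
    rewrite -rsum_nat -big_mkcondr /= sum1_card; congr INR.
    by apply: eq_card => v; rewrite [RHS]unfold_in /= !inE.
  rewrite -rsum_in_const -rsum_mull -rsum_add; apply: rsum_le => v.
  rewrite inE => vs; rewrite w_in ?aK // blockE //.
  have p4 : (0 < p * / 4)%R by lra.
  have lnp4 : (- ln (p * / 4) <= ln (INR Z) + ln 4)%R.
    by rewrite ln_mult ?ln_Rinv; lra.
  case: close => /=.
    apply: (Rle_trans _ (- ln (p * / 4))); last lra.
    apply: Ropp_le_contravar; apply: ln_le => //.
    by apply: Rmult_le_compat_l; lra.
  apply: (Rle_trans _ (- ln (p * / 4 * / INR K))).
    apply: Ropp_le_contravar; apply: ln_le.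
      by apply: Rmult_lt_0_compat => //; apply: Rinv_0_lt_compat; lra.
    by rewrite Rinv_mult; lra.
  by rewrite ln_mult ?ln_Rinv; try lra; apply: Rinv_0_lt_compat; lra.
suff out_s : (\rsum_(v | (v \in J) && (v \notin s)) - ln (w (f v) (block v))
    <= INR (size s))%R.
  by apply: Rle_trans (Rplus_le_compat _ _ _ _ in_s out_s) _; lra.
have [/pred0P none|/pred0Pn[v0 /andP[v0J v0s]]] :=
    boolP (pred0b [pred v | (v \in J) && (v \notin s)]).
  by rewrite big_pred0 //; lra.
have op := out v0 v0J v0s.
(* By [ln_le_sub1] each of the [(1 - p) * #|J|] outside vertices pays at most [/ (1 - p) - 1], in
   total [p * #|J| = size s]. *)
apply: (Rle_trans _ (\rsum_(v in [set v in J | v \notin s]) (/ (1 - p) - 1))%R).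
  rewrite [X in (_ <= X)%R](eq_bigl (fun v => (v \in J) && (v \notin s))); last first.
    by move=> v; rewrite inE.
  apply: rsum_le => v /andP[vJ vs]; rewrite /w block_out // eqxx.
  rewrite -ln_Rinv //; apply: ln_le_sub1; exact: Rinv_0_lt_compat.
rewrite rsum_in_const.
have pE : (INR (size s) = p * INR #|J|)%R by rewrite /p; field; lra.
have -> : INR #|[set v in J | v \notin s]| = ((1 - p) * INR #|J|)%R by lra.
by rewrite pE; right; field; lra.
Qed.

End Blocks.

(** * Nearly transitive sets *)

Section NearStep.
Variables (V I : finType) (E : rel V) (col : V -> V -> I).
Hypothesis E_irr : forall x, ~~ E x x.
Hypothesis E_tour : forall x y, x != y -> E x y = ~~ E y x.
Implicit Types (J S : {set V}) (i : I).

Section BadVertices.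
Variables (s : seq V) (b : nat).
Hypotheses (us : uniq s) (b_gt0 : 0 < b).

(** This is the block where label [x] would first appear if [s] were sorted by label. *)
Definition rank_block (f : V -> nat) (x : nat) : nat := #|[set w in s | f w < x]| %/ b.

Definition bad (f : V -> nat) : {set V} :=
  [set v in s | ~~ close (index v s %/ b) (rank_block f (f v))].

Definition col_nbrs i v : {set V} :=
  [set w in s | E v w && (col v w == i) || E w v && (col w v == i)].

Definition back_nbrs v : {set V} :=
  [set w in s | E w v && (index v s < index w s) || E v w && (index w s < index v s)].

(* If the quantile is too high, many later vertices have a smaller label; if it
   is too low, many earlier ones have a label at least as large. *)
Lemma bad_degree i (f : V -> nat) v :
  (forall u w, u \in s -> w \in s -> avoid E col i u w ->
     index u s %/ b < index w s %/ b -> f u < f w) ->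
  v \in bad f -> b <= #|col_nbrs i v| + #|back_nbrs v|.
Proof.
move=> mono; rewrite inE => /andP[vs]; set a := index v s %/ b.
set A := [set w in s | f w < f v].
have sub (W : {set V}) : W \subset col_nbrs i v :|: back_nbrs v -> b <= #|W| ->
    b <= #|col_nbrs i v| + #|back_nbrs v|.
  move=> WS bW; apply: (leq_trans bW); apply: (leq_trans (subset_leq_card WS)).
  by rewrite cardsU leq_subr.
have cardD (X Y : {set V}) : #|X| <= #|Y| + #|X :\: Y|.
  by rewrite -(cardsID Y X) leq_add2r subset_leq_card // subsetIr.
rewrite /close /rank_block -/A negb_and -!ltnNge => /orP[low|high].
(* Being off by more than one block leaves a full block of slack: [D] has [a * b] elements and [A]
   fewer than [(a - 1) * b]. The other case is symmetric. *)
- pose D := [set w in s | index w s < a * b].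
  have cD : #|D| = a * b.
    rewrite card_index_lt //; apply/minn_idPl.
    by rewrite (leq_trans (leq_trunc_div _ _)) // ltnW // index_mem.
  apply: (sub (D :\: A)); last first.
    have := cardD D A; rewrite cD.
    have : #|A| < (#|A| %/ b).+1 * b := ltn_ceil _ b_gt0.
    by move: low; move: (#|A| %/ b) #|A| => g cA; nia.
  apply/subsetP=> w; rewrite !inE => /andP[nA /andP[ws wD]].
  rewrite ws /= -leqNgt in nA *.
  have wv : index w s < index v s := leq_trans wD (leq_trunc_div _ _).
  have nvw : w != v by apply: contraTneq wv => ->; rewrite ltnn.
  rewrite wv andbT [index v s < _]ltnNge (ltnW wv) andbF /=.
  case Ewv : (E w v); rewrite E_tour 1?eq_sym // Ewv /=; last by rewrite orbT.
  rewrite orbF; apply: contraTT nA => ncol; rewrite -ltnNge.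
  by apply: mono; rewrite // /avoid ?Ewv ?ncol // ltn_divLR.
- pose D := [set w in s | index w s < a.+1 * b].
  have cD : #|D| <= a.+1 * b by rewrite card_index_lt // geq_minl.
  apply: (sub (A :\: D)); last first.
    have := cardD A D; have := leq_trunc_div #|A| b.
    by move: high cD; move: (#|A| %/ b) #|A| => g cA; nia.
  apply/subsetP=> w; rewrite !inE => /andP[nD /andP[ws fw]].
  rewrite ws /= -leqNgt in nD *.
  have wv : index v s < index w s := leq_trans (ltn_ceil _ b_gt0) nD.
  have nvw : w != v by apply: contraTneq wv => ->; rewrite ltnn.
  rewrite wv andbT [index w s < _]ltnNge (ltnW wv) andbF orbF /=.
  case Evw : (E v w); rewrite E_tour // Evw /=; last by rewrite orbT.
  rewrite !orbF; apply: contraTT fw => ncol; rewrite -leqNgt ltnW //.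
  by apply: mono; rewrite // /avoid ?Evw ?ncol // -/a leq_divRL.
Qed.

Lemma sum_col_nbrs v : \sum_i #|col_nbrs i v| <= size s.
Proof.
pose P i w := E v w && (col v w == i) || E w v && (col w v == i).
rewrite (eq_bigr (fun i => \sum_(w in s) P i w)); last first.
  move=> i _; rewrite -big_mkcondr sum1_card; apply: eq_card => w.
  by rewrite inE [RHS]unfold_in.
rewrite exchange_big /= -(card_uniqP us) -sum1_card leq_sum // => w _.
have [->|vw] := eqVneq w v.
  by rewrite big1 // => i _; rewrite /P (negbTE (E_irr v)).
rewrite /P E_tour 1?eq_sym //; case: (E w v) => /=.
  rewrite (bigD1 (col w v)) //= big1 ?addn0 ?leq_b1 // => i.
  by rewrite eq_sym => /negbTE->.
rewrite (bigD1 (col v w)) //= big1 ?addn0 ?leq_b1 // => i.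
by rewrite eq_sym orbF => /negbTE->.
Qed.

(** Each backward edge is seen from both of its ends. *)
Lemma sum_back_nbrs : \sum_(v in s) #|back_nbrs v| <= 2 * back E s.
Proof.
have backE : back E s = \sum_(v in s) \sum_(w in s) (E w v && (index v s < index w s)).
  by rewrite /back (big_uniq _ us); apply: eq_bigr => v _; rewrite (big_uniq _ us).
have backE' : back E s = \sum_(v in s) \sum_(w in s) (E v w && (index w s < index v s)).
  by rewrite backE exchange_big.
rewrite mul2n -addnn {1}backE backE' -big_split /= leq_sum // => v _.
rewrite -big_split /= /back_nbrs -sum1_card.
rewrite (eq_bigl (fun w => (w \in s) && (E w v && (index v s < index w s)
   || E v w && (index w s < index v s)))); last by move=> w; rewrite inE.
rewrite big_mkcondr /= leq_sum // => w _.
by case: (E w v && _); case: (E v w && _).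
Qed.

(** [bad_degree] is summed over vertices and colours: the colour neighbourhoods of a vertex total at
    most [size s] over all colours, while backward edges are charged again for every colour. *)
Lemma sum_bad (f : I -> V -> nat) :
  (forall i u w, u \in s -> w \in s -> avoid E col i u w ->
     index u s %/ b < index w s %/ b -> f i u < f i w) ->
  (\sum_i #|bad (f i)|) * b <= size s * size s + #|I| * (2 * back E s).
Proof.
move=> mono.
apply: (@leq_trans (\sum_i \sum_(v in s) (#|col_nbrs i v| + #|back_nbrs v|))).
  rewrite big_distrl leq_sum //= => i _.
  rewrite -sum_nat_const big_mkcond [leqRHS]big_mkcond leq_sum //= => v _.
  case: ifP => // vb; have vs : v \in s by move: vb; rewrite inE => /andP[].
  by rewrite vs; apply: bad_degree vb; apply: mono.
rewrite (eq_bigr (fun i => \sum_(v in s) #|col_nbrs i v| + \sum_(v in s) #|back_nbrs v|));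
  last by move=> i _; rewrite big_split.
rewrite big_split /= sum_nat_const leq_add //.
  rewrite exchange_big /= -{1}(card_uniqP us) -sum_nat_const leq_sum // => v _.
  exact: sum_col_nbrs.
by rewrite leq_mul2l sum_back_nbrs orbT.
Qed.

End BadVertices.

Variables (eps c : R).

(** The bound is per vertex and averaged over the colours; the ranks are fixed before the
    labellings. *)
Definition good J : Prop := exists r : I -> V -> nat, forall f : I -> V -> nat,
  (forall i, compatible E col i J (r i) (f i)) ->
  (\rsum_i ent J (f i) <= INR #|I| * (INR #|J| * (eps * ln (INR #|J|) + c)))%R.

(** Each block has at most [2 * #|J| / K] vertices, so induction saves [eps * (ln K - ln 2)] per
    vertex of [s]. By [gain] this pays for [ln Z + ln 4 + 1] from [ent_blocks] and for 3 more from
    the bad vertices. *)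
Lemma near_step K Z J s : uniq s -> {subset s <= J} -> 3 < K -> K <= size s ->
  #|J| <= Z * size s -> K * K * back E s <= size s * size s -> K * K <= #|I| ->
  (0 <= eps)%R -> (0 <= c)%R ->
  (ln (INR Z) + ln 4 + 4 <= eps * (ln (INR K) - ln 2))%R ->
  (forall J', #|J'| < #|J| -> good J') -> good J.
Proof.
move=> us sJ K3 Ks JZ near KI eps0 c0 gain IH.
set n := size s in Ks JZ near *.
(* Rounding up makes [K] blocks cover [s]; with [K <= n] it at most doubles the block size. *)
pose b := (n %/ K).+1.
have K0 : 0 < K by lia.
have n0 : 0 < n by lia.
have bKn : b * K <= 2 * n.
  by rewrite mulSn; have := leq_trunc_div n K; lia.
have nbK : n < b * K := ltn_ceil _ K0.
have idxK v : v \in s -> index v s %/ b < K.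
  by move=> vs; rewrite ltn_divLR // mulnC (leq_trans _ (ltnW nbK)) // index_mem.
pose Ja a := [set v in J | block s K b v == a].
have nJ : n <= #|J|.
  by rewrite /n -(card_uniqP us); apply: subset_leq_card; apply/subsetP.
have blk (a : 'I_K.+1) : a != K :> nat -> #|Ja a| <= b.
  move=> aK; pose X t := [set w in s | index w s < t].
  have: #|X (a.+1 * b) :\: X (a * b)| <= b.
    rewrite cardsD (setIidPr _); last first.
      apply/subsetP=> w; rewrite !inE => /andP[-> /=] /leq_trans; apply.
      by rewrite leq_mul2r leqnSn orbT.
    by rewrite !card_index_lt //; lia.
  apply: leq_trans; apply: subset_leq_card; apply/subsetP=> v.
  rewrite !inE => /andP[_ /eqP va]; have [vs|vs] := boolP (v \in s); last first.
    by move: aK; rewrite -va block_out ?eqxx.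
  by rewrite -va blockE // andTb -leqNgt leq_trunc_div ltn_ceil.
have Jout (a : 'I_K.+1) : a = K :> nat -> #|Ja a| < #|J|.
  move=> aK; have [x xs] : exists x, x \in s.
    have : 0 < size s := n0.
    by case: (s) => // x l _; exists x; rewrite mem_head.
  apply: proper_card; apply/properP; split.
    by apply/subsetP=> v; rewrite inE => /andP[].
  exists x; first exact: sJ.
  rewrite inE (sJ _ xs) /=; apply/eqP => xa.
  by have := idxK x xs; rewrite -(blockE idxK xs) xa aK ltnn.
have ltJ a : #|Ja a| < #|J|.
  have [aK|aK] := eqVneq (nat_of_ord a) K; first exact: Jout.
  apply: leq_ltn_trans (blk a aK) (leq_trans _ nJ).
  have : n %/ K <= n %/ 4 by apply: leq_div2l.
  have := leq_trunc_div n 4; rewrite /b; lia.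
have [ra raP] := fin_all_exists (fun a => IH (Ja a) (ltJ a)).
(* [B] exceeds all inner ranks, so the merged rank is lexicographic: first the block, then the rank
   given by induction. *)
pose B := (\max_a \max_i \max_v ra a i v).+1.
have raB a i v : ra a i v < B.
  rewrite ltnS; apply: (leq_trans (leq_bigmax v)).
  by apply: (leq_trans (leq_bigmax (F := fun i => \max_v ra a i v) i)); apply: (leq_bigmax a).
exists (fun i v => block s K b v * B + ra (block s K b v) i v) => f fP.
have mono i u w : u \in s -> w \in s -> avoid E col i u w ->
    index u s %/ b < index w s %/ b -> f i u < f i w.
  move=> uS wS Guw lt_uw; apply: fP => //; try exact: sJ.
  rewrite -!(blockE idxK) // in lt_uw.
  have : (block s K b u).+1 * B <= block s K b w * B by rewrite leq_mul2r lt_uw orbT.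
  by rewrite mulSn; have := raB (block s K b u) i u; lia.
pose bad_i i := #|bad s b (f i)|.
have step i : (ent J (f i) <= \rsum_a ent (Ja a) (f i)
     + (INR n * (ln (INR Z) + ln 4 + 1) + ln (INR K) * INR (bad_i i)))%R.
  exact: (@ent_blocks V s K b idxK Z J (f i) (rank_block s b (f i)) us sJ n0 JZ K0).
have nr : (0 < INR n)%R by apply: lt_0_INR; apply/ltP.
have Kr : (4 <= INR K)%R by have := le_INR 4 K (elimT leP K3); rewrite /=; lra.
(* Of the factor 3, one comes from the edges of colour [i] through [K * K <= #|I|] and two from the
   backward edges through [near]. *)
have KB : (INR K * INR (\sum_i bad_i i) <= 3 * INR #|I| * INR n)%R.
  apply: (Rmult_le_reg_l (INR n)) => //.
  have := @sum_bad s b us isT f mono; rewrite -/n -/bad_i.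
  set X := \sum_i _ => h.
  have : n * (K * X) <= n * (3 * #|I| * n).
    apply: (@leq_trans (K * K * (X * b))).
      rewrite (_ : K * K * (X * b) = (b * K) * (K * X)); last by lia.
      by rewrite leq_mul2r (ltnW nbK) orbT.
    apply: (@leq_trans (K * K * (n * n + #|I| * (2 * back E s)))).
      by rewrite leq_mul2l h orbT.
    have h1 : K * K * (n * n) <= #|I| * (n * n) by rewrite leq_mul2r KI orbT.
    have h2 : #|I| * (2 * (K * K * back E s)) <= #|I| * (2 * (n * n)).
      by rewrite leq_mul2l leq_mul2l near !orbT.
    by lia.
  by move=> /leP/le_INR; rewrite !mult_INR /=; lra.
have lnKB : (ln (INR K) * INR (\sum_i bad_i i) <= 3 * INR #|I| * INR n)%R.
  apply: Rle_trans KB; apply: Rmult_le_compat_r; first exact: pos_INR.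
  by have := @ln_le_sub1 (INR K); lra.
have q0 := pos_INR #|I|.
apply: Rle_trans (rsum_le (fun i _ => step i)) _.
rewrite rsum_add exchange_big /=.
have -> : (\rsum_i (INR n * (ln (INR Z) + ln 4 + 1) + ln (INR K) * INR (bad_i i)) =
    INR #|I| * (INR n * (ln (INR Z) + ln 4 + 1)) + ln (INR K) * INR (\sum_i bad_i i))%R.
  by rewrite rsum_add rsum_const rsum_mull -rsum_nat (_ : #|_| = #|I|).
set D := (ln (INR K) - ln 2)%R in gain.
set L := (eps * ln (INR #|J|) + c)%R.
(* The saving is claimed only for vertices of [s]; [cs a] is zero for the part outside [s]. *)
pose cs a := #|[set v in [set v in s] | block s K b v == a]|.
have blocks a : (\rsum_i ent (Ja a) (f i) <=
    INR #|I| * L * INR #|Ja a| + - (INR #|I| * (eps * D)) * INR (cs a))%R.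
  apply: Rle_trans (raP a f _) _.
    move=> i u w; rewrite !inE => /andP[uJ /eqP ua] /andP[wJ /eqP wa] Guw lt_uw.
    by apply: fP => //; rewrite ua wa ltn_add2l.
  suff h : (INR #|Ja a| * (eps * ln (INR #|Ja a|) + c) <=
           INR #|Ja a| * L - eps * D * INR (cs a))%R.
    by have := Rmult_le_compat_l _ _ _ q0 h; lra.
  have [Ja0|Ja0] := posnP #|Ja a|.
    have -> : cs a = 0.
      apply/eqP; rewrite -leqn0 -Ja0; apply: subset_leq_card; apply/subsetP=> v.
      by rewrite !inE => /andP[/sJ-> ->].
    by rewrite Ja0 /=; lra.
  have Jar : (0 < INR #|Ja a|)%R by apply: lt_0_INR; apply/ltP.
  have [aK|aK] := eqVneq (nat_of_ord a) K.
    have -> : cs a = 0.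
      apply/eqP; rewrite cards_eq0; apply/eqP/setP=> v; rewrite !inE.
      apply/negP=> /andP[vs /eqP va]; have := idxK v vs.
      by rewrite -(blockE idxK vs) va aK ltnn.
    have : (eps * ln (INR #|Ja a|) <= eps * ln (INR #|J|))%R.
      by apply: Rmult_le_compat_l => //; apply: ln_INR_le; apply: ltnW.
    move=> h; rewrite Rmult_0_r Rminus_0_r; apply: Rmult_le_compat_l; first lra.
    by rewrite /L; lra.
  have lnJa : (ln (INR #|Ja a|) <= ln (INR #|J|) - D)%R.
    have h : (INR #|Ja a| * INR K <= 2 * INR #|J|)%R.
      rewrite -mult_INR -[2%R]/(INR 2) -mult_INR; apply/le_INR/leP.
      by have := blk a aK; move: bKn nJ; nia.
    have : (ln (INR #|Ja a| * INR K) <= ln (2 * INR #|J|))%R.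
      by apply: ln_le => //; apply: Rmult_lt_0_compat => //; lra.
    rewrite !ln_mult //; try lra; first by rewrite /D; lra.
    by apply: lt_0_INR; apply/ltP; apply: leq_trans nJ.
  have csJ : (INR (cs a) <= INR #|Ja a|)%R.
    apply/le_INR/leP; apply: subset_leq_card; apply/subsetP=> v.
    by rewrite !inE => /andP[/sJ-> ->].
  have D0 : (0 <= eps * D)%R.
    have := ln_INR_ge0 Z; have := ln_INR_ge0 4; rewrite (_ : INR 4 = 4%R) /=; last lra.
    by lra.
  apply: (Rle_trans _ (INR #|Ja a| * (eps * (ln (INR #|J|) - D) + c))).
    apply: Rmult_le_compat_l; first lra.
    by have := Rmult_le_compat_l _ _ _ eps0 lnJa; lra.
  have := Rmult_le_compat_l _ _ _ D0 csJ.
  by rewrite /L; lra.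
have total : (\rsum_a \rsum_i ent (Ja a) (f i) <=
    INR #|I| * L * INR #|J| + - (INR #|I| * (eps * D)) * INR n)%R.
  apply: Rle_trans (rsum_le (fun a _ => blocks a)) _.
  rewrite rsum_add !rsum_mull -!rsum_nat !sum_card_preim cardsE (card_uniqP us).
  by right.
have := Rmult_le_compat_l _ _ _ (Rmult_le_pos _ _ q0 (Rlt_le _ _ nr)) gain.
move=> gain'; apply: Rle_trans (Rplus_le_compat_r _ _ _ total) _.
have fin q l j d m z B' : (B' <= 3 * q * m -> q * m * (z + 4) <= q * m * d ->
    q * l * j + - (q * d) * m + (q * (m * (z + 1)) + B') <= q * (j * l))%R by lra.
exact: fin lnKB gain'.
Qed.

End NearStep.

(** * The induction and the choice of parameters *)

Lemma rsum_le_exists (T : finType) (x0 : T) (F G : T -> R) :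
  (\rsum_i F i <= \rsum_i G i)%R -> exists i, (F i <= G i)%R.
Proof.
move=> le_sum; apply: NNPP => none.
have gt i : (G i < F i)%R by apply: Rnot_le_lt => h; apply: none; exists i.
have := rsum_le (P := fun i => i != x0) (fun i _ => Rlt_le _ _ (gt i)).
by move: le_sum; rewrite (bigD1 x0) //= [X in (_ <= X)%R](bigD1 x0) //=; have := gt x0; lra.
Qed.

(** * Longest-path labellings and the main induction *)

Section LongPath.
Variables (V I : finType) (E : rel V) (col : V -> V -> I).

(** [f v] is the number of edges of a longest rank-increasing path ending at [v], and [x :: p] is a
    longest one overall. Its vertices are distinct because the ranks strictly increase. *)
Lemma longest_increasing_path i (r : V -> nat) (x0 : V) :
  exists f x p, [/\ compatible E col i [set: V] r f, forall v, f v < size (x :: p),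
    path (avoid E col i) x p & uniq (x :: p)].
Proof.
pose H u v := avoid E col i u v && (r u < r v).
have H_uniq x p : path H x p -> uniq (x :: p).
  move=> Hp; apply: (@sorted_uniq _ (fun u v => r u < r v)).
  - by move=> v u w; apply: ltn_trans.
  - by move=> u; rewrite /= ltnn.
  by apply: sub_path Hp => u v /andP[].
pose P v n := [exists x, exists t : n.-tuple V, path H x t && (last x t == v)].
have P0 v : exists n, P v n.
  by exists 0; apply/existsP; exists v; apply/existsP; exists [tuple] => /=.
have Pmax v n : P v n -> n <= #|V|.
  case/existsP=> x /existsP[t /andP[/H_uniq/card_uniqP Ht _]].
  by apply: leq_trans (max_card (mem (x :: t))); rewrite Ht /= size_tuple.
pose f v := ex_maxn (P0 v) (Pmax v).
have [v0 _ max_f] := @arg_maxnP _ x0 predT f isT.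
have [x [p [Hp pv0]]] : exists x p, path H x p /\ size p = f v0.
  rewrite /f; case: ex_maxnP => n /existsP[x /existsP[t /andP[Ht _]]] _.
  by exists x, t; rewrite size_tuple.
exists f, x, p; split.
- move=> u v _ _ Guv ruv; rewrite /f; case: (ex_maxnP (P0 v)) => n _; apply.
  case: ex_maxnP => k /existsP[y /existsP[t /andP[Ht /eqP tu]]] _.
  apply/existsP; exists y; apply/existsP; exists [tuple of rcons t v].
  by rewrite /= rcons_path last_rcons Ht tu /H Guv ruv eqxx.
- by move=> v; rewrite /= pv0 ltnS; apply: max_f.
- by apply: sub_path Hp => u v /andP[].
- exact: H_uniq.
Qed.

Hypothesis E_irr : forall x, ~~ E x x.
Hypothesis E_tour : forall x y, x != y -> E x y = ~~ E y x.

(** Strong induction on [#|J|]: [gain] serves the nearly transitive case and [few] the far one. The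
    constant is the cost of naming a path in [ent_paths]. *)
Lemma all_good K Z (eps : R) (J : {set V}) : 3 < K -> 0 < Z -> K * K <= #|I| ->
  (0 <= eps)%R ->
  (ln (INR Z) + ln 4 + 4 <= eps * (ln (INR K) - ln 2))%R ->
  (INR #|I| / INR Z + INR (2 * (K * K) * (Z * Z)) <= INR #|I| * eps)%R ->
  good E col eps (ln (INR (2 * (2 * (K * K) * Z)))) J.
Proof.
move=> K3 Z0 KI eps0 gain few; set c := ln _.
have c0 : (0 <= c)%R := ln_INR_ge0 _.
have q0 := pos_INR #|I|.
elim: {J}_.+1 {-2}J (ltnSn #|J|) => // n IH J leJn.
have J0 := pos_INR #|J|.
(* For small sets the constant [c] alone suffices; otherwise [#|J| > K * Z] yields [K <= size s]
   below. *)
have [small|big] := leqP #|J| (K * Z).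
  exists (fun _ _ => 0) => f _.
  apply: Rle_trans (rsum_le (fun i _ => ent_le_card J (f i))) _.
  rewrite rsum_const; apply: Rmult_le_compat_l => //; apply: Rmult_le_compat_l => //.
  have : (ln (INR #|J|) <= c)%R by apply: ln_INR_le; nia.
  by have := Rmult_le_pos _ _ eps0 (ln_INR_ge0 #|J|); lra.
have [[s [us sJ JZ near]]|far] := classic (exists s, [/\ uniq s, {subset s <= J},
    #|J| <= Z * size s & K * K * back E s <= size s * size s]).
  apply: (near_step E_irr E_tour us sJ K3 _ JZ near KI eps0 c0 gain).
    by rewrite -(leq_pmul2r Z0) mulnC [_ * Z]mulnC; lia.
  by move=> J' ltJ'; apply: IH; lia.
have [s us sJ JZ|r rP] := @far_step V I E col K Z J (ltn_trans (isT : 0 < 3) K3) Z0.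
- by rewrite ltnNge; apply/negP => near; apply: far; exists s.
exists r => f fP; apply: Rle_trans (rP f fP) _.
have -> : (INR #|I| * (INR #|J| * (eps * ln (INR #|J|) + c)) =
  INR #|J| * (ln (INR #|J|) * (INR #|I| * eps) + INR #|I| * c))%R by lra.
apply: Rmult_le_compat_l => //; apply: Rplus_le_compat_r.
by apply: Rmult_le_compat_l => //; apply: ln_INR_ge0.
Qed.

(** Some colour does no worse than average. Comparing its entropy with [ent_ge] gives
    [ln N <= eps * ln N + ln c + ln M], which is then exponentiated. *)
Lemma long_avoiding_path K Z (eps : R) (x0 : V) :
  3 < K -> 0 < Z -> K * K <= #|I| -> (0 <= eps)%R ->
  (ln (INR Z) + ln 4 + 4 <= eps * (ln (INR K) - ln 2))%R ->
  (INR #|I| / INR Z + INR (2 * (K * K) * (Z * Z)) <= INR #|I| * eps)%R ->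
  exists i x p, [/\ path (avoid E col i) x p, uniq (x :: p) &
    (/ INR (2 * (2 * (K * K) * Z)) * Rpower (INR #|V|) (1 - eps) <= INR (size (x :: p)))%R].
Proof.
move=> K3 Z0 KI eps0 gain few.
have [r rP] := all_good [set: V] K3 Z0 KI eps0 gain few.
have [f fP] := fin_all_exists (fun i => longest_increasing_path i (r i) x0).
have /card_gt0P[i0 _] : 0 < #|I| by lia.
have := rP f (fun i => let: ex_intro _ (ex_intro _ (And4 h _ _ _)) := fP i in h).
set X := (INR #|[set: V]| * _)%R => sum_le.
have [|i ent_i] := @rsum_le_exists I i0 (fun i => ent [set: V] (f i)) (fun=> X).
  by rewrite rsum_const; apply: sum_le.
have [x [p [_ fM pP up]]] := fP i.
exists i, x, p; split=> //.
have := ent_ge [set: V] fM; move: ent_i; rewrite /X cardsT.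
set c := INR (2 * _); set M := INR (size _); set N := INR #|V| => ent_i ge.
have N0 : (0 < N)%R by apply: lt_0_INR; apply/ltP/card_gt0P; exists x0.
have M0 : (0 < M)%R by apply: lt_0_INR; apply/ltP.
have c0 : (0 < c)%R by apply: lt_0_INR; apply/ltP; rewrite !muln_gt0 Z0 /=; lia.
have le_ln : (ln N <= eps * ln N + ln c + ln M)%R.
  by apply: (Rmult_le_reg_l N) => //; lra.
rewrite -(exp_ln M) // -[X in (/ X * _)%R](exp_ln c) // -exp_Ropp /Rpower -exp_plus.
have [lt|eq] : (- ln c + (1 - eps) * ln N <= ln M)%R by lra.
  exact/Rlt_le/exp_increasing.
by right; rewrite eq.
Qed.

End LongPath.

(** * Powers of two as parameters *)

Lemma INR_exp2 n : INR (expn 2 n) = (2 ^ n)%R.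
Proof. by elim: n => [|n IH]; rewrite ?expn0 // expnS mult_INR IH. Qed.

Lemma ln_exp2 n : ln (INR (expn 2 n)) = (INR n * ln 2)%R.
Proof. by rewrite INR_exp2 ln_pow; lra. Qed.

(** [m] is taken maximal for the first property; the second records that [m + 1] fails it. *)
Lemma exp2_parameters q : 0 < q -> exists m,
  expn 2 (6 * (m * m)) <= q /\ (log2 (INR q) <= 6 * (INR m + 1) * (INR m + 1))%R.
Proof.
move=> q0; pose P m := expn 2 (6 * (m * m)) <= q.
have P0 : exists m, P m by exists 0.
have Pq m : P m -> m <= q.
  move=> Pm; apply: leq_trans Pm; apply: leq_trans (ltnW (ltn_expl m (ltnSn 1))) _.
  by rewrite leq_exp2l //; nia.
case: (ex_maxnP P0 Pq) => m Pm max_m; exists m; split=> //.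
have lt_q : q <= expn 2 (6 * (m.+1 * m.+1)).
  by rewrite ltnW // ltnNge; apply/negP => /max_m; rewrite ltnn.
have ln2 : (0 < ln 2)%R by have := ln_lt_2; lra.
apply: (Rmult_le_reg_r (ln 2)) => //; rewrite /log2 /Rdiv Rmult_assoc Rinv_l ?Rmult_1_r; last lra.
apply: Rle_trans (ln_INR_le lt_q) _; rewrite ln_exp2 !mult_INR.
rewrite (S_INR m) (_ : INR 6 = 6%R); last by rewrite /=; lra.
by right; ring.
Qed.

Theorem theorem1p6 :
  exists C : R, (0 < C)%R /\
  forall q : nat, (4 <= q)%N ->
  exists cq : R, (0 < cq)%R /\
  forall (N : nat) (E : rel 'I_N) (col : 'I_N -> 'I_N -> 'I_q),
    (0 < N)%N -> is_tournament E ->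
    exists p : seq 'I_N,
      is_dipath E p /\ color_avoiding col p /\
      (cq * Rpower (INR N) (1 - C / sqrt (log2 (INR q))) <= INR (size p))%R.
Proof.
(* The exponent loss is [8 / m], and [sqrt L <= 5 * m] turns it into at most [40 / sqrt L]. *)
exists 40%R; split; first lra; move=> q q4.
have q0 : 0 < q by lia.
have ln2 : (/ 2 < ln 2)%R := ln_lt_2.
have [m [m_le L_le]] := exp2_parameters q0.
set L := log2 (INR q) in L_le *.
have L1 : (1 <= L)%R.
  apply: (Rmult_le_reg_r (ln 2)); first lra.
  rewrite /L /log2 /Rdiv Rmult_assoc Rinv_l ?Rmult_1_r ?Rmult_1_l; last lra.
  apply: ln_le; first lra.
  by rewrite -[2%R]/(INR 2); apply/le_INR/leP; lia.
have sL : (0 < sqrt L)%R by apply: sqrt_lt_R0; lra.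
have sqrt_le t : (0 <= t -> L <= t * t -> sqrt L <= t)%R.
  by move=> t0 Lt; rewrite -(sqrt_square t) //; apply: sqrt_le_1_alt.
(* For [m <= 1], [L <= 24] makes the exponent nonpositive, and a single vertex is enough. *)
have [m2|m1] := leqP 2 m; last first.
  exists 1%R; split; first lra; move=> N E col N0 _; exists [:: Ordinal N0].
  split; first by []; split; first by exists (Ordinal q0).
  have m1r : (INR m <= 1)%R by apply: (le_INR m 1); apply/leP.
  have sL5 : (sqrt L <= 5)%R.
    by apply: sqrt_le; have := pos_INR m; nra.
  have : (1 <= 40 / sqrt L)%R.
    by apply: (Rmult_le_reg_r (sqrt L)) => //; rewrite /Rdiv Rmult_assoc Rinv_l; lra.
  move=> h; rewrite Rmult_1_l /Rpower.
  have : ((1 - 40 / sqrt L) * ln (INR N) <= 0)%R by have := ln_INR_ge0 N; nra.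
  move=> e0; apply: (Rle_trans _ (exp 0)); last by rewrite exp_0; right.
  case: e0 => [/exp_increasing/Rlt_le //|->]; exact: Rle_refl.
set Z := expn 2 m; set K := expn 2 (m * m).
have m2r : (2 <= INR m)%R by apply: (le_INR 2 m); apply/leP.
have Z0 : 0 < Z by rewrite expn_gt0.
have K3 : 3 < K by apply: (@leq_trans (expn 2 (2 * 2))); rewrite // leq_exp2l // leq_mul.
have KKq : K * K <= q.
  by apply: leq_trans m_le; rewrite /K -expnD leq_exp2l //; lia.
have mZ : m <= Z by apply/ltnW/ltn_expl.
have Zq : Z * (2 * (K * K) * (Z * Z)) <= q.
  have -> : Z * (2 * (K * K) * (Z * Z)) = expn 2 (m + (1 + (m * m + m * m) + (m + m))).
    by rewrite /K /Z !expnD expn1.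
  by apply: leq_trans m_le; rewrite leq_exp2l //; nia.
have Zr : (0 < INR Z)%R by apply: lt_0_INR; apply/ltP.
have qr : (0 < INR q)%R by apply: lt_0_INR; apply/ltP.
exists (/ INR (2 * (2 * (K * K) * Z)))%R; split.
  by apply/Rinv_0_lt_compat/lt_0_INR/ltP; rewrite !muln_gt0 Z0 /=; lia.
move=> N E col N0 [E_irr E_tour].
(* Since [8 / m <= 4], it suffices that [(7 * m - 6) * ln 2 >= 4], which follows from [m >= 2] and
   [ln 2 > / 2]. *)
have gain : (ln (INR Z) + ln 4 + 4 <= 8 / INR m * (ln (INR K) - ln 2))%R.
  rewrite /Z /K !ln_exp2 mult_INR (_ : 4 = 2 * 2)%R; last lra.
  rewrite ln_mult; try lra.
  have -> : (8 / INR m * (INR m * INR m * ln 2 - ln 2) = (8 * INR m - 8 / INR m) * ln 2)%R.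
    by field; lra.
  have : (8 / INR m <= 4)%R.
    by apply: (Rmult_le_reg_r (INR m)); rewrite ?/Rdiv ?Rmult_assoc ?Rinv_l; lra.
  by nra.
(* Each summand is at most [q / m]: the first by [m <= Z], the second by [Zq]. *)
have few : (INR #|'I_q| / INR Z + INR (2 * (K * K) * (Z * Z)) <= INR #|'I_q| * (8 / INR m))%R.
  rewrite card_ord.
  have h1 : (INR q / INR Z <= INR q / INR m)%R.
    apply: Rmult_le_compat_l; first lra.
    by apply: Rinv_le_contravar; [lra | apply/le_INR/leP].
  have h2 : (INR (2 * (K * K) * (Z * Z)) <= INR q / INR m)%R.
    apply: (Rmult_le_reg_r (INR m)); first lra.
    rewrite /Rdiv Rmult_assoc Rinv_l ?Rmult_1_r -?mult_INR; last lra.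
    by apply/le_INR/leP; apply: leq_trans Zq; rewrite [leqLHS]mulnC leq_mul.
  have : (0 <= INR q / INR m)%R by apply: Rmult_le_pos; [lra | apply/Rlt_le/Rinv_0_lt_compat; lra].
  by lra.
have eps0 : (0 <= 8 / INR m)%R.
  by apply: Rmult_le_pos; [lra | apply/Rlt_le/Rinv_0_lt_compat; lra].
have KI : K * K <= #|'I_q| by rewrite card_ord.
have [i [x [p [Gp up len]]]] :=
  @long_avoiding_path _ _ E col E_irr E_tour K Z _ (Ordinal N0) K3 Z0 KI eps0 gain few.
exists (x :: p); split; last split.
- by rewrite /is_dipath up andbT; apply: sub_path Gp => u v /andP[].
- by exists i; apply: sub_path Gp => u v /andP[].
apply: Rle_trans len; rewrite card_ord; apply: Rmult_le_compat_l.
  by apply/Rlt_le/Rinv_0_lt_compat/lt_0_INR/ltP; rewrite !muln_gt0 Z0 /=; lia.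
apply: Rle_Rpower; first by apply: (le_INR 1); apply/leP.
suff : (8 / INR m <= 40 / sqrt L)%R by lra.
have sLm : (sqrt L <= 5 * INR m)%R by apply: sqrt_le; nra.
apply: (Rmult_le_reg_r (INR m * sqrt L)); first by apply: Rmult_lt_0_compat; lra.
have -> : (8 / INR m * (INR m * sqrt L) = 8 * sqrt L)%R by field; lra.
by have -> : (40 / sqrt L * (INR m * sqrt L) = 40 * INR m)%R; [field; lra | lra].
Qed.
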